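(* Let $n_1,n_2,n_3$ be positive integers and let $\Omega\subseteq[n_1]\times[n_2]\times[n_3]$ be a fixed index set. Let $\hat a\in\mathbb{R}^{n_1}$, $\hat b\in\mathbb{R}^{n_2}$, $\hat c\in\mathbb{R}^{n_3}$ be nonzero vectors with $\|\hat a\|=\|\hat b\|=1$, and let $\widehat{\mathcal{A}}=\hat a\otimes\hat b\otimes\hat c$. Let $Z$ be the matrix and $\hat\Psi$ the set of polynomials associated with $(\hat a,\hat b,\hat c)$ and $\Omega$ as defined in the context. Assume that $\mathrm{rank}\, Z=n_1+n_2$ and that the four pairs $(\pm\hat a,\pm\hat b)$ (all independent choices of signs) are the only common zeros $(a,b)$ with $\|a\|=\|b\|=1$ of the polynomials in $\hat\Psi$. Suppose moreover that $(\hat a,\hat b)$ is nonsingular (with respect to $\Omega$) and that $\hat c_k\ne0$ for all $k\in[n_3]$. Then there exist a constant $C>0$, depending on $(\hat a,\hat b,\hat c)$, and an $\varepsilon>0$ such that the following holds: for every $\mathcal{A}$ with observed entries $\mathcal{A}_{ijk}=\widehat{\mathcal{A}}_{ijk}+\delta\mathcal{A}_{ijk}$, $(i,j,k)\in\Omega$, satisfying $\|\delta\mathcal{A}\|_\Omega<\varepsilon$, and for every minimizer $(a^*,b^* )$ of the biquadratic optimization problem $$\min\ f(a,b)=\sum_{k=1}^{n_3}\ \sum_{1\le s<t\le m_k}\left(\mathcal{A}_{i_sj_sk}a_{i_t}b_{j_t}-\mathcal{A}_{i_tj_tk}a_{i_s}b_{j_s}\right)^2\quad\text{subject to}\quad \|a\|^2=\|b\|^2=1,$$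 with $a\in\mathbb{R}^{n_1}$, $b\in\mathbb{R}^{n_2}$, if $c^*=(c_1^*,\dots,c_{n_3}^* )$ is given by $$c_k^*=\Big(\sum_{s=1}^{m_k}\mathcal{A}_{i_sj_sk}a^*_{i_s}b^*_{j_s}\Big)\Big/\Big(\sum_{s=1}^{m_k}(a^*_{i_s}b^*_{j_s})^2\Big),\qquad k=1,\dots,n_3,$$ then $$\|a^*\otimes b^*\otimes c^*-\hat a\otimes\hat b\otimes\hat c\|\le C\,\|\delta\mathcal{A}\|_\Omega.$$
   Context: For a positive integer $n$, $[n]=\{1,\dots,n\}$; $\|\cdot\|$ is the Euclidean norm on vectors and the Hilbert–Schmidt norm $\|\mathcal{B}\|=\left(\sum_{i,j,k}\mathcal{B}_{ijk}^2\right)^{1/2}$ on tensors in $\mathbb{R}^{n_1\times n_2\times n_3}$; $(a\otimes b\otimes c)_{ijk}=a_ib_jc_k$; $e_i$ denotes a standard basis vector of the appropriate dimension. For a tensor, $\|\mathcal{B}\|_\Omega=\left(\sum_{(i,j,k)\in\Omega}|\mathcal{B}_{ijk}|^2\right)^{1/2}$. For each $k\in[n_3]$, let $\Omega_k=\{(i,j)\in[n_1]\times[n_2]:(i,j,k)\in\Omega\}$, let $m_k=|\Omega_k|$, and enumerate $\Omega_k=\{(i_1,j_1),\dots,(i_{m_k},j_{m_k})\}$ (the enumeration depends on $k$). For $k\in[n_3]$ and $1\le s<t\le m_k$, define the polynomial in $(a,b)\in\mathbb{R}^{n_1}\times\mathbb{R}^{n_2}$ $$\hat\psi_{s,t,k}(a,b)=\left(\widehat{\mathcal{A}}_{i_sj_sk}a_{i_t}b_{j_t}-\widehat{\mathcal{A}}_{i_tj_tk}a_{i_s}b_{j_s}\right)^2,$$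 and let $\hat\Psi$ be the set of all polynomials $\hat\psi_{s,t,k}$ with $k\in[n_3]$, $1\le s<t\le m_k$. Define the column vectors $$\hat z_{s,t,k}=\sqrt2\,\hat c_k\begin{bmatrix}\hat a_{i_s}\hat b_{j_s}\hat b_{j_t}e_{i_t}-\hat a_{i_t}\hat b_{j_t}\hat b_{j_s}e_{i_s}\\ \hat a_{i_s}\hat b_{j_s}\hat a_{i_t}e_{j_t}-\hat a_{i_t}\hat b_{j_t}\hat a_{i_s}e_{j_s}\end{bmatrix}\in\mathbb{R}^{n_1+n_2}.$$ Let $\hat Z$ be the matrix whose rows are all the vectors $(\hat z_{s,t,k})^T$ with $k\in[n_3]$, $1\le s<t\le m_k$, and let $$Z=\begin{bmatrix}\hat Z\\ \hat D\end{bmatrix},\qquad \hat D=\begin{bmatrix}\hat a&0\\0&\hat b\end{bmatrix}^T\in\mathbb{R}^{2\times(n_1+n_2)}.$$ A pair $(a,b)$ of nonzero vectors $a\in\mathbb{R}^{n_1}$, $b\in\mathbb{R}^{n_2}$ is called singular if there exists $k\in[n_3]$ such that $m_k=0$ or $a_{i_1}b_{j_1}=\cdots=a_{i_{m_k}}b_{j_{m_k}}=0$, where $\Omega_k=\{(i_1,j_1),\dots,(i_{m_k},j_{m_k})\}$; it is called nonsingular if it is not singular. Thus the denominators in the formula for $c^*$ are all nonzero exactly when $(a^*,b^* )$ is nonsingular. *)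

(* Defs.v *)
From HB Require Import structures.
From mathcomp Require Import all_boot all_order all_algebra.
From mathcomp Require Import classical_sets reals.

Set Implicit Arguments.
Unset Strict Implicit.
Unset Printing Implicit Defensive.

Import Order.TTheory GRing.Theory Num.Theory.

Local Open Scope ring_scope.

(* The entry B_{ijk} is B (i, j, k), that is, B ((i, j), k). *)
Notation tensor R n1 n2 n3 := {ffun 'I_n1 * 'I_n2 * 'I_n3 -> R}.

(* MathComp-Analysis' `|x| on matrices is the sup norm, hence this definition. *)
Definition enorm (R : realType) (n : nat) (x : 'cV[R]_n) : R :=
  Num.sqrt (\sum_(i < n) x i 0 ^+ 2).

Definition tnorm (R : realType) (n1 n2 n3 : nat) (B : tensor R n1 n2 n3) : R :=
  Num.sqrt (\sum_(i < n1) \sum_(j < n2) \sum_(k < n3) B (i, j, k) ^+ 2).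

Definition tnorm_on (R : realType) (n1 n2 n3 : nat)
    (Om : {set 'I_n1 * 'I_n2 * 'I_n3}) (B : tensor R n1 n2 n3) : R :=
  Num.sqrt (\sum_(x in Om) `|B x| ^+ 2).

Definition outer (R : realType) (n1 n2 n3 : nat)
    (a : 'cV[R]_n1) (b : 'cV[R]_n2) (c : 'cV[R]_n3) : tensor R n1 n2 n3 :=
  [ffun x => a x.1.1 0 * b x.1.2 0 * c x.2 0].

Definition slice (n1 n2 n3 : nat) (Om : {set 'I_n1 * 'I_n2 * 'I_n3})
    (k : 'I_n3) : {set 'I_n1 * 'I_n2} :=
  [set p : 'I_n1 * 'I_n2 | (p, k) \in Om].

Notation msize Om k := #|slice Om k|.

(* For e : enumeration Om, the pair (i_s, j_s) of the slice k is e k s. *)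
Definition enumeration (n1 n2 n3 : nat) (Om : {set 'I_n1 * 'I_n2 * 'I_n3}) :=
  forall k : 'I_n3, 'I_(msize Om k) -> 'I_n1 * 'I_n2.

Definition enumerates (n1 n2 n3 : nat) (Om : {set 'I_n1 * 'I_n2 * 'I_n3})
    (e : enumeration Om) : Prop :=
  forall k : 'I_n3, injective (e k) /\ codom (e k) =i slice Om k.

(* Defined for an arbitrary tensor A: the polynomials of PsiHat are the case
   A = outer a b c, and the objective function is a sum of such terms. *)
Definition psi (R : realType) (n1 n2 n3 : nat)
    (Om : {set 'I_n1 * 'I_n2 * 'I_n3}) (e : enumeration Om)
    (A : tensor R n1 n2 n3) (k : 'I_n3) (s t : 'I_(msize Om k))
    (a : 'cV[R]_n1) (b : 'cV[R]_n2) : R :=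
  (A (e k s, k) * a (e k t).1 0 * b (e k t).2 0
   - A (e k t, k) * a (e k s).1 0 * b (e k s).2 0) ^+ 2.

Definition PsiHat (R : realType) (n1 n2 n3 : nat)
    (Om : {set 'I_n1 * 'I_n2 * 'I_n3}) (e : enumeration Om)
    (Ahat : tensor R n1 n2 n3) : set ('cV[R]_n1 -> 'cV[R]_n2 -> R) :=
  [set p | exists (k : 'I_n3) (s t : 'I_(msize Om k)),
     (s < t)%N /\ p = psi e Ahat s t].

Definition common_zero (R : realType) (n1 n2 : nat)
    (P : set ('cV[R]_n1 -> 'cV[R]_n2 -> R)) (a : 'cV[R]_n1) (b : 'cV[R]_n2) :
    Prop :=
  forall p, P p -> p a b = 0.

Definition zhat (R : realType) (n1 n2 n3 : nat)
    (Om : {set 'I_n1 * 'I_n2 * 'I_n3}) (e : enumeration Om)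
    (a : 'cV[R]_n1) (b : 'cV[R]_n2) (c : 'cV[R]_n3)
    (k : 'I_n3) (s t : 'I_(msize Om k)) : 'cV[R]_(n1 + n2) :=
  let: (i_s, j_s) := e k s in
  let: (i_t, j_t) := e k t in
  (Num.sqrt 2 * c k 0) *:
    col_mx
      ((a i_s 0 * b j_s 0 * b j_t 0) *: delta_mx i_t 0
       - (a i_t 0 * b j_t 0 * b j_s 0) *: delta_mx i_s 0)
      ((a i_s 0 * b j_s 0 * a i_t 0) *: delta_mx j_t 0
       - (a i_t 0 * b j_t 0 * a i_s 0) *: delta_mx j_s 0).

(* The triples (k, s, t) with s < t, which index the rows of Zhat. *)
Definition row_index (n1 n2 n3 : nat) (Om : {set 'I_n1 * 'I_n2 * 'I_n3}) :
    {set {k : 'I_n3 & ('I_(msize Om k) * 'I_(msize Om k))%type}} :=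
  [set x : {k : 'I_n3 & ('I_(msize Om k) * 'I_(msize Om k))%type} |
    let: existT k (s, t) := x in (s < t)%N].

Definition Zhat (R : realType) (n1 n2 n3 : nat)
    (Om : {set 'I_n1 * 'I_n2 * 'I_n3}) (e : enumeration Om)
    (a : 'cV[R]_n1) (b : 'cV[R]_n2) (c : 'cV[R]_n3) :
    'M[R]_(#|row_index Om|, n1 + n2) :=
  \matrix_(r < #|row_index Om|)
    (let: existT k (s, t) := enum_val r in (zhat e a b c s t)^T).

Definition Dhat (R : realType) (n1 n2 : nat)
    (a : 'cV[R]_n1) (b : 'cV[R]_n2) : 'M[R]_(2, n1 + n2) :=
  (block_mx a 0 0 b)^T.

Definition Zmx (R : realType) (n1 n2 n3 : nat)
    (Om : {set 'I_n1 * 'I_n2 * 'I_n3}) (e : enumeration Om)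
    (a : 'cV[R]_n1) (b : 'cV[R]_n2) (c : 'cV[R]_n3) :
    'M[R]_(#|row_index Om| + 2, n1 + n2) :=
  col_mx (Zhat e a b c) (Dhat a b).

(* Only meant for nonzero a and b. *)
Definition singular (R : realType) (n1 n2 n3 : nat)
    (Om : {set 'I_n1 * 'I_n2 * 'I_n3}) (e : enumeration Om)
    (a : 'cV[R]_n1) (b : 'cV[R]_n2) : Prop :=
  exists k : 'I_n3, msize Om k = 0%N \/
    forall s : 'I_(msize Om k), a (e k s).1 0 * b (e k s).2 0 = 0.

Definition nonsingular (R : realType) (n1 n2 n3 : nat)
    (Om : {set 'I_n1 * 'I_n2 * 'I_n3}) (e : enumeration Om)
    (a : 'cV[R]_n1) (b : 'cV[R]_n2) : Prop :=
  ~ singular e a b.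

Definition objective (R : realType) (n1 n2 n3 : nat)
    (Om : {set 'I_n1 * 'I_n2 * 'I_n3}) (e : enumeration Om)
    (A : tensor R n1 n2 n3) (a : 'cV[R]_n1) (b : 'cV[R]_n2) : R :=
  \sum_(k < n3) \sum_(s < msize Om k) \sum_(t < msize Om k | (s < t)%N)
    psi e A s t a b.

Definition feasible (R : realType) (n1 n2 : nat)
    (a : 'cV[R]_n1) (b : 'cV[R]_n2) : Prop :=
  enorm a ^+ 2 = 1 /\ enorm b ^+ 2 = 1.

Definition minimizer (R : realType) (n1 n2 n3 : nat)
    (Om : {set 'I_n1 * 'I_n2 * 'I_n3}) (e : enumeration Om)
    (A : tensor R n1 n2 n3) (a : 'cV[R]_n1) (b : 'cV[R]_n2) : Prop :=
  feasible a b /\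
  forall (a' : 'cV[R]_n1) (b' : 'cV[R]_n2),
    feasible a' b' -> objective e A a b <= objective e A a' b'.

(* The quotient is meaningful (its denominator is nonzero) for every k exactly
   when (a, b) is nonsingular; otherwise x / 0 = 0 applies. *)
Definition cstar (R : realType) (n1 n2 n3 : nat)
    (Om : {set 'I_n1 * 'I_n2 * 'I_n3}) (e : enumeration Om)
    (A : tensor R n1 n2 n3) (a : 'cV[R]_n1) (b : 'cV[R]_n2) : 'cV[R]_n3 :=
  \col_(k < n3)
    ((\sum_(s < msize Om k) A (e k s, k) * a (e k s).1 0 * b (e k s).2 0)
     / (\sum_(s < msize Om k) (a (e k s).1 0 * b (e k s).2 0) ^+ 2)).

(* Main.v *)
Require Import Defs.
From HB Require Import structures.
From mathcomp Require Import all_boot all_order all_algebra.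
From mathcomp Require Import boolp classical_sets reals.
From mathcomp Require Import prodnormedzmodule topology normedtype derive.
From mathcomp Require Import ring lra.

Set Implicit Arguments.
Unset Strict Implicit.
Unset Printing Implicit Defensive.

Import Order.TTheory GRing.Theory Num.Theory.

Local Open Scope ring_scope.

(** Let [resid A k p q a b] be the bilinear expression whose square is the term
    of the objective attached to the positions [p] and [q] of the slice [k], and
    let t be the norm of the noise on [Om].

    The residuals of the reference tensor vanish at the reference point, so
    those of the noisy tensor are O(t) there and the noisy objective is O(t^2).
    A minimizer does no worse; hence all noisy residuals at the minimizer are
    O(t), and so are the residuals of the reference tensor, which differ from
    them by O(t) ([minimizer_resid_le]).

    It remains to see that on the product of the unit spheres small residuals of
    the reference tensor force (a, b) to be linearly close to one of the four
    sign choices ([error_bound]).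
    - Near a zero ([local_error_bound]), write the point as reference plus
      displacement w. The rows of [Zhat] are sqrt 2 times the gradients of the
      residuals, and the rows of [Dhat] are the normals of the two spheres.
      Therefore Z w consists of residuals and of terms quadratic in w. As Z has
      full column rank, |w| is bounded by a multiple of |Z w|, and for small w
      the quadratic terms are absorbed.
    - Away from the zeros ([objective_gap]), the objective is continuous and
      positive on a compact set, hence bounded below, and the residuals cannot
      all be small.

    Finally each coefficient of [cstar] solves a one-dimensional least squares
    problem with a denominator bounded below by nonsingularity, so it depends in
    a Lipschitz way on the data ([least_squares_stability]). The signs cancel in
    the product of the three factors ([recovery_bound]).

    Closeness of vectors is measured in the sup norm [`|x|] of matrices; this
    only changes the constants. *)

(** * Norms of vectors and matrices *)

Lemma mx_coord_le (R : realType) m n (x : 'M[R]_(m, n)) i j : `|x i j| <= `|x|.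
Proof.
rewrite [leRHS]/Num.norm /= mx_normrE.
exact: (le_bigmax _ (fun ij : 'I_m * 'I_n => `|x ij.1 ij.2|) (i, j)).
Qed.

Lemma mx_norm_le (R : realType) m n (x : 'M[R]_(m, n)) t :
  0 <= t -> (forall i j, `|x i j| <= t) -> `|x| <= t.
Proof.
move=> t0 xt; rewrite [leLHS]/Num.norm /= mx_normrE.
by apply/bigmax_leP; split => // -[i j] _; exact: xt.
Qed.

Lemma normr_col_mxu (R : realType) m1 m2 n (u : 'M[R]_(m1, n))
    (v : 'M[R]_(m2, n)) : `|u| <= `|col_mx u v|.
Proof. by apply: mx_norm_le => // i j; rewrite -(col_mxEu u v) mx_coord_le. Qed.

Lemma normr_col_mxd (R : realType) m1 m2 n (u : 'M[R]_(m1, n))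
    (v : 'M[R]_(m2, n)) : `|v| <= `|col_mx u v|.
Proof. by apply: mx_norm_le => // i j; rewrite -(col_mxEd u v) mx_coord_le. Qed.

Lemma mulmx_norm_le (R : realType) m n (W : 'M[R]_(m, n)) (y : 'cV[R]_n) :
  `|W *m y| <= (\sum_i \sum_j `|W i j|) * `|y|.
Proof.
apply: mx_norm_le => [|i k].
  by rewrite mulr_ge0// sumr_ge0// => i _; rewrite sumr_ge0.
rewrite mxE (le_trans (ler_norm_sum _ _ _))// (bigD1 i)//= mulrDl.
rewrite -[leLHS]addr0 lerD//; last first.
  by rewrite mulr_ge0// sumr_ge0// => l _; rewrite sumr_ge0.
by rewrite mulr_suml ler_sum// => j _; rewrite normrM ler_wpM2l// mx_coord_le.
Qed.

(** A left inverse of [Z] exists, and multiplication by it is Lipschitz. *)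
Lemma full_column_rank_lower_bound (R : realType) m n (Z : 'M[R]_(m, n)) :
  \rank Z = n ->
  exists2 kappa : R, 0 < kappa & forall w : 'cV[R]_n, `|w| <= kappa * `|Z *m w|.
Proof.
move=> rZ; have /row_fullP[W WZ] : row_full Z by rewrite /row_full rZ.
exists (1 + \sum_i \sum_j `|W i j|) => [|w].
  by rewrite ltr_pwDl// sumr_ge0// => i _; rewrite sumr_ge0.
rewrite -{1}[w]mul1mx -WZ -mulmxA (le_trans (mulmx_norm_le _ _))//.
by rewrite ler_wpM2r// lerDr.
Qed.

(** * Unit vectors *)

Lemma enorm1_sum (R : realType) n (x : 'cV[R]_n) :
  enorm x = 1 <-> \sum_i x i 0 ^+ 2 = 1.
Proof.
have s0 : 0 <= \sum_i x i 0 ^+ 2 by rewrite sumr_ge0// => i _; rewrite sqr_ge0.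
rewrite -(sqr_sqrtr s0) -/(enorm x); split=> [->|/eqP]; first by rewrite expr1n.
by rewrite sqrp_eq1 ?sqrtr_ge0// => /eqP.
Qed.

Lemma feasible_unit (R : realType) n1 n2 (a : 'cV[R]_n1) (b : 'cV[R]_n2) :
  feasible a b <-> enorm a = 1 /\ enorm b = 1.
Proof.
rewrite /feasible; split=> [[/eqP + /eqP]|[-> ->]]; last by rewrite expr1n.
by rewrite !sqrp_eq1 ?sqrtr_ge0// => /eqP-> /eqP->.
Qed.

Lemma enorm1_coord_le (R : realType) n (x : 'cV[R]_n) i :
  enorm x = 1 -> `|x i 0| <= 1.
Proof.
move=> /enorm1_sum x1; rewrite -(ler_pXn2r (n := 2)) ?nnegrE// expr1n.
rewrite real_normK ?num_real// -x1 (bigD1 i)//= lerDl sumr_ge0// => j _.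
exact: sqr_ge0.
Qed.

Lemma enorm1_sign (R : realType) n (x : 'cV[R]_n) (s : bool) :
  enorm x = 1 -> enorm ((-1) ^+ s *: x) = 1.
Proof.
move=> /enorm1_sum x1; apply/enorm1_sum; rewrite -[RHS]x1.
by apply: eq_bigr => i _; rewrite mxE exprMn sqrr_sign mul1r.
Qed.

(** Expanding the two normalizations shows that a displacement along the sphere
    is orthogonal to [x] up to half of its squared norm. *)
Lemma enorm1_tangent (R : realType) n (x u : 'cV[R]_n) :
  enorm x = 1 -> enorm (x + u) = 1 -> `|(x^T *m u) 0 0| <= n%:R * `|u| ^+ 2.
Proof.
move=> /enorm1_sum x1 /enorm1_sum xu1.
have sumu : `|\sum_i u i 0 ^+ 2| <= n%:R * `|u| ^+ 2.
  rewrite (le_trans (ler_norm_sum _ _ _))// -[X in X%:R]card_ord.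
  rewrite mulr_natl -sumr_const ler_sum// => i _.
  by rewrite normrX lerXn2r ?nnegrE ?mx_coord_le.
have E : (x^T *m u) 0 0 = - (\sum_i u i 0 ^+ 2) / 2.
  have : \sum_i (x i 0 ^+ 2 + 2 * (x i 0 * u i 0) + u i 0 ^+ 2) = 1.
    by rewrite -[RHS]xu1; apply: eq_bigr => i _; rewrite mxE; ring.
  rewrite !big_split/= x1 -mulr_sumr => H.
  have -> : (x^T *m u) 0 0 = \sum_i x i 0 * u i 0.
    by rewrite mxE; apply: eq_bigr => i _; rewrite mxE.
  by lra.
move: sumu; rewrite E !ler_norml => /andP[? ?]; apply/andP; split; lra.
Qed.

(** * Residuals and the local error bound *)

(** The signed square root of [psi], attached to two positions [p] and [q] of
    the slice [k]: estimates for it are linear in the data. *)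
Definition resid (R : realType) n1 n2 n3 (A : tensor R n1 n2 n3) (k : 'I_n3)
    (p q : 'I_n1 * 'I_n2) (a : 'cV[R]_n1) (b : 'cV[R]_n2) : R :=
  A (p, k) * a q.1 0 * b q.2 0 - A (q, k) * a p.1 0 * b p.2 0.

Lemma normr_resid_sign (R : realType) n1 n2 n3 (A : tensor R n1 n2 n3) k p q a b
    (s t : bool) :
  `|resid A k p q ((-1) ^+ s *: a) ((-1) ^+ t *: b)| = `|resid A k p q a b|.
Proof.
have -> : resid A k p q ((-1) ^+ s *: a) ((-1) ^+ t *: b)
        = (-1) ^+ s * ((-1) ^+ t * resid A k p q a b).
  by rewrite /resid !mxE; ring.
by rewrite !normrMsign.
Qed.

(** [zhat] is sqrt 2 times the gradient of [resid] at the reference point. *)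
Lemma zhat_mul (R : realType) n1 n2 n3 (Om : {set 'I_n1 * 'I_n2 * 'I_n3})
    (e : enumeration Om) (a : 'cV[R]_n1) (b : 'cV[R]_n2) (c : 'cV[R]_n3) k
    (s t : 'I_(msize Om k)) (u : 'cV[R]_n1) (v : 'cV[R]_n2) :
  let p := e k s in let q := e k t in let A := outer a b c in
  ((zhat e a b c s t)^T *m col_mx u v) 0 0 =
  Num.sqrt 2 * (A (p, k) * (u q.1 0 * b q.2 0 + a q.1 0 * v q.2 0)
              - A (q, k) * (u p.1 0 * b p.2 0 + a p.1 0 * v p.2 0)).
Proof.
rewrite /zhat; case: (e k s) => i j; case: (e k t) => i' j' /=.
rewrite linearZ/= -scalemxAl tr_col_mx mul_row_col !linearB/= !linearZ/=.
rewrite !trmx_delta !mulmxDl -!scalemxAl !mulNmx -!rowE !mxE !ffunE/=.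
by ring.
Qed.

Lemma resid_expand (R : realType) n1 n2 n3 (a : 'cV[R]_n1) (b : 'cV[R]_n2)
    (c : 'cV[R]_n3) k p q (u : 'cV[R]_n1) (v : 'cV[R]_n2) :
  let A := outer a b c in
  A (p, k) * (u q.1 0 * b q.2 0 + a q.1 0 * v q.2 0)
    - A (q, k) * (u p.1 0 * b p.2 0 + a p.1 0 * v p.2 0) =
  resid A k p q (a + u) (b + v)
    - (A (p, k) * u q.1 0 * v q.2 0 - A (q, k) * u p.1 0 * v p.2 0).
Proof. by rewrite /resid !mxE !ffunE /=; ring. Qed.

Lemma outer_coord_le (R : realType) n1 n2 n3 (a : 'cV[R]_n1) (b : 'cV[R]_n2)
    (c : 'cV[R]_n3) x :
  enorm a = 1 -> enorm b = 1 -> `|outer a b c x| <= `|c|.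
Proof.
move=> a1 b1; rewrite ffunE !normrM (le_trans _ (mx_coord_le c x.2 0))//.
by rewrite ler_piMl// mulr_ile1// enorm1_coord_le.
Qed.

(** The quadratic term of [resid] and the curvature of the spheres are the only
    obstructions to reading the size of the displacement off [Z]. *)
Lemma Zmx_mul_le (R : realType) n1 n2 n3 (Om : {set 'I_n1 * 'I_n2 * 'I_n3})
    (e : enumeration Om) (a u : 'cV[R]_n1) (b v : 'cV[R]_n2) (c : 'cV[R]_n3) t :
  enorm a = 1 -> enorm b = 1 -> enorm (a + u) = 1 -> enorm (b + v) = 1 ->
  0 <= t ->
  (forall k (s s' : 'I_(msize Om k)), (s < s')%N ->
    `|resid (outer a b c) k (e k s) (e k s') (a + u) (b + v)| <= t) ->
  `|Zmx e a b c *m col_mx u v|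
    <= 2 * t + (4 * `|c| + n1%:R + n2%:R) * `|col_mx u v| ^+ 2.
Proof.
move=> a1 b1 au1 bv1 t0 rt.
set h := `|col_mx u v|; have h0 : 0 <= h by exact: normr_ge0.
have uh : `|u| <= h by exact: normr_col_mxu.
have vh : `|v| <= h by exact: normr_col_mxd.
have h20 : 0 <= h ^+ 2 by exact: sqr_ge0.
have n0 (n : nat) : 0 <= n%:R * h ^+ 2 by rewrite mulr_ge0.
have c0 : 0 <= `|c| * h ^+ 2 by rewrite mulr_ge0.
have tan n (x w : 'cV[R]_n) : enorm x = 1 -> enorm (x + w) = 1 -> `|w| <= h ->
    `|(x^T *m w) 0 0| <= n%:R * h ^+ 2.
  move=> x1 xw1 wh; rewrite (le_trans (enorm1_tangent x1 xw1))//.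
  by rewrite ler_wpM2l// lerXn2r ?nnegrE.
have quad x p : `|outer a b c x * u p.1 0 * v p.2 0| <= `|c| * h ^+ 2.
  rewrite -mulrA normrM ler_pM ?outer_coord_le// normrM expr2.
  by rewrite ler_pM ?(le_trans (mx_coord_le _ _ _)).
apply: mx_norm_le => [|r j].
  by have := n0 n1; have := n0 n2; lra.
rewrite {j}ord1 /Zmx mul_col_mx.
case: (split_ordP r) => {}r ->; rewrite ?col_mxEu ?col_mxEd.
  have -> : (Zhat e a b c *m col_mx u v) r 0
          = (row r (Zhat e a b c) *m col_mx u v) 0 0.
    by rewrite -row_mul [RHS]mxE.
  rewrite rowK; have := enum_valP r; case: (enum_val r) => k [s s'].
  rewrite inE => ss'; rewrite zhat_mul resid_expand.
  have sq2 : `|Num.sqrt (2 : R)| <= 2.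
    rewrite ger0_norm ?sqrtr_ge0// -[leRHS]ger0_norm// -sqrtr_sqr.
    by rewrite ler_wsqrtr//; lra.
  have B : `|resid (outer a b c) k (e k s) (e k s') (a + u) (b + v)
      - (outer a b c (e k s, k) * u (e k s').1 0 * v (e k s').2 0
         - outer a b c (e k s', k) * u (e k s).1 0 * v (e k s).2 0)|
      <= t + 2 * (`|c| * h ^+ 2).
    rewrite (le_trans (ler_normB _ _))// lerD ?rt//.
    rewrite (le_trans (ler_normB _ _))// [2 * _]mulr_natl mulr2n.
    by rewrite lerD ?quad.
  rewrite normrM (le_trans (ler_pM _ _ sq2 B))//.
  by have := n0 n1; have := n0 n2; lra.
have -> : Dhat a b *m col_mx u v = col_mx (a^T *m u) (b^T *m v).
  rewrite /Dhat tr_block_mx !trmx0.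
  by rewrite (mul_block_col a^T 0 0 b^T u v) !mul0mx addr0 add0r.
case: (split_ordP (r : 'I_(1 + 1))) => l ->; rewrite (ord1 l).
  rewrite (col_mxEu (a^T *m u)).
  by have := tan _ a u a1 au1 uh; have := n0 n2; lra.
rewrite (col_mxEd (a^T *m u)).
by have := tan _ b v b1 bv1 vh; have := n0 n1; lra.
Qed.

(** With h the norm of the displacement, full column rank and [Zmx_mul_le] give
    h <= K (2 t + Q h^2). Once K Q h <= 1/2 the quadratic term is absorbed by
    the left-hand side. *)
Lemma local_error_bound (R : realType) n1 n2 n3
    (Om : {set 'I_n1 * 'I_n2 * 'I_n3}) (e : enumeration Om)
    (a : 'cV[R]_n1) (b : 'cV[R]_n2) (c : 'cV[R]_n3) :
  enorm a = 1 -> enorm b = 1 -> \rank (Zmx e a b c) = (n1 + n2)%N ->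
  exists K rho : R, [/\ 0 < K, 0 < rho &
    forall u v t, enorm (a + u) = 1 -> enorm (b + v) = 1 -> 0 <= t ->
    (forall k (s s' : 'I_(msize Om k)), (s < s')%N ->
      `|resid (outer a b c) k (e k s) (e k s') (a + u) (b + v)| <= t) ->
    `|u| <= rho -> `|v| <= rho -> `|u| <= K * t /\ `|v| <= K * t].
Proof.
move=> a1 b1 /full_column_rank_lower_bound[K K0 HK].
set Q := 4 * `|c| + n1%:R + n2%:R.
have Q0 : 0 <= Q by rewrite !addr_ge0// mulr_ge0.
have D0 : 0 < 2 * (K * Q) + 1 by rewrite ltr_wpDl// !mulr_ge0// ltW.
(* The radius is at most 1 / (2 K Q), and the extra 1 keeps it finite. *)
exists (4 * K), (2 * (K * Q) + 1)^-1; split; rewrite ?invr_gt0 ?mulr_gt0//.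
move=> u v t au1 bv1 t0 rt urho vrho.
set h := `|col_mx u v|.
suff H : h <= 4 * K * t.
  by split; [exact: le_trans (normr_col_mxu u v) H
           | exact: le_trans (normr_col_mxd u v) H].
have h0 : 0 <= h by exact: normr_ge0.
have hrho : h <= (2 * (K * Q) + 1)^-1.
  apply: mx_norm_le => [|i j]; first by rewrite invr_ge0 ltW.
  case: (split_ordP i) => l ->; rewrite ?col_mxEu ?col_mxEd.
    exact: le_trans (mx_coord_le _ _ _) urho.
  exact: le_trans (mx_coord_le _ _ _) vrho.
have small : h * (2 * (K * Q) + 1) <= 1 by rewrite -ler_pdivlMr// div1r.
have step : h <= K * (2 * t + Q * h ^+ 2).
  rewrite (le_trans (HK _))// ler_pM2l//.
  exact: Zmx_mul_le.
have : h * (h * (2 * (K * Q) + 1)) <= h * 1 by rewrite ler_wpM2l.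
have : 0 <= h ^+ 2 by exact: sqr_ge0.
by move: step; lra.
Qed.

(** * The global error bound *)

Import numFieldNormedType.Exports.
Local Open Scope classical_set_scope.

Lemma compact_sphere (R : realType) n :
  compact [set x : 'rV[R]_n | enorm x^T = 1].
Proof.
apply: bounded_closed_compact.
  exists 1; split; first exact: num_real.
  move=> M M1 x /= x1; apply: mx_norm_le => [|i j].
    by rewrite (le_trans ler01)// ltW.
  by rewrite ord1 -[x]trmxK mxE (le_trans (enorm1_coord_le _ x1))// ltW.
have -> : [set x : 'rV[R]_n | enorm x^T = 1]
        = (fun x : 'rV[R]_n => \sum_i x 0 i ^+ 2) @^-1` [set y | y = 1].
  have E (x : 'rV[R]_n) : \sum_i x^T i 0 ^+ 2 = \sum_i x 0 i ^+ 2.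
    by apply: eq_bigr => i _; rewrite mxE.
  by apply/seteqP; split=> x /=; rewrite enorm1_sum E.
apply: preimage_closed; last exact: closed_eq.
move=> x _; move: x.
apply: continuous_big => [|i _ x]; first exact: add_continuous.
by apply: continuousM; exact: coord_continuous.
Qed.

Lemma compact_pos_lower_bound (R : realType) (T : topologicalType) (K : set T)
    (f : T -> R) :
  compact K -> continuous f -> (forall x, K x -> 0 < f x) ->
  exists2 m, 0 < m & forall x, K x -> m <= f x.
Proof.
move=> cK cf f0; have [[x0 Kx0]|K0] := pselect (K !=set0); last first.
  by exists 1 => // x Kx; exfalso; apply: K0; exists x.
have [x /set_mem Kx xmin] :=
    compact_EVT_min (ex_intro _ x0 Kx0) cK (continuous_subspaceT cf).
by exists (f x); [exact: f0 | move=> y /mem_set; exact: xmin].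
Qed.

Lemma objective_continuous (R : realType) n1 n2 n3
    (Om : {set 'I_n1 * 'I_n2 * 'I_n3}) (e : enumeration Om)
    (A : tensor R n1 n2 n3) :
  continuous (fun x : 'rV[R]_n1 * 'rV[R]_n2 => objective e A x.1^T x.2^T).
Proof.
have c1 i : continuous (fun x : 'rV[R]_n1 * 'rV[R]_n2 => x.1^T i 0).
  have -> : (fun x : 'rV[R]_n1 * 'rV[R]_n2 => x.1^T i 0) = (fun x => x.1 0 i).
    by apply/funext => x; rewrite mxE.
  move=> x.
  by apply: (@continuous_comp _ _ _ fst (fun y : 'rV[R]_n1 => y 0 i));
    [exact: cvg_fst | exact: coord_continuous].
have c2 i : continuous (fun x : 'rV[R]_n1 * 'rV[R]_n2 => x.2^T i 0).
  have -> : (fun x : 'rV[R]_n1 * 'rV[R]_n2 => x.2^T i 0) = (fun x => x.2 0 i).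
    by apply/funext => x; rewrite mxE.
  move=> x.
  by apply: (@continuous_comp _ _ _ snd (fun y : 'rV[R]_n2 => y 0 i));
    [exact: cvg_snd | exact: coord_continuous].
have mono d i j :
    continuous (fun x : 'rV[R]_n1 * 'rV[R]_n2 => d * x.1^T i 0 * x.2^T j 0).
  move=> x; have cd : {for x, continuous (fun=> d)} by exact: cst_continuous.
  exact: (continuousM (continuousM cd (c1 i x)) (c2 j x)).
apply: continuous_big => [|k _]; first exact: add_continuous.
apply: continuous_big => [|s _]; first exact: add_continuous.
apply: continuous_big => [|t _]; first exact: add_continuous.
suff r : forall k p q, continuous (fun x => resid A k p q x.1^T x.2^T).
  have rst := r k (e k s) (e k t).
  by move=> x; apply: (continuousM (rst x) (rst x)).
move=> l p q x; exact: (continuousB (mono _ _ _ x) (mono _ _ _ x)).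
Qed.

Definition npairs n1 n2 n3 (Om : {set 'I_n1 * 'I_n2 * 'I_n3}) : nat :=
  \sum_(k < n3) \sum_(s < msize Om k) \sum_(t < msize Om k | (s < t)%N) 1.

Lemma objective_le (R : realType) n1 n2 n3
    (Om : {set 'I_n1 * 'I_n2 * 'I_n3}) (e : enumeration Om)
    (A : tensor R n1 n2 n3) a b (t : R) :
  (forall k (s s' : 'I_(msize Om k)), (s < s')%N ->
    `|resid A k (e k s) (e k s') a b| <= t) ->
  objective e A a b <= (npairs Om)%:R * t ^+ 2.
Proof.
move=> rt; rewrite /objective /npairs natr_sum mulr_suml.
apply: ler_sum => k _; rewrite natr_sum mulr_suml.
apply: ler_sum => s _; rewrite natr_sum mulr_suml.
apply: ler_sum => s' ss'; rewrite mul1r -/(resid A k (e k s) (e k s') a b ^+ 2).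
have rn := normr_ge0 (resid A k (e k s) (e k s') a b).
rewrite -[leLHS]real_normK ?num_real//; apply: lerXn2r; rewrite ?nnegrE//.
  exact: (le_trans rn (rt _ _ _ ss')).
exact: rt.
Qed.

Lemma psi_le_objective (R : realType) n1 n2 n3
    (Om : {set 'I_n1 * 'I_n2 * 'I_n3}) (e : enumeration Om)
    (A : tensor R n1 n2 n3) a b k (s t : 'I_(msize Om k)) :
  (s < t)%N -> psi e A s t a b <= objective e A a b.
Proof.
move=> st; rewrite /objective (bigD1 k)//= (bigD1 s)//= (bigD1 t)//=.
rewrite -!addrA lerDl !addr_ge0//; do ? (apply: sumr_ge0 => ? _);
  exact: sqr_ge0.
Qed.

(** A zero of the objective is a common zero of the polynomials, so the objective
    is positive off the four sign choices; on the closed set of points at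
    distance at least [rho] from them compactness makes this uniform. *)
Lemma objective_gap (R : realType) n1 n2 n3
    (Om : {set 'I_n1 * 'I_n2 * 'I_n3}) (e : enumeration Om)
    (A : tensor R n1 n2 n3) (a0 : 'cV[R]_n1) (b0 : 'cV[R]_n2) (rho : R) :
  0 < rho ->
  (forall a b, enorm a = 1 -> enorm b = 1 -> common_zero (PsiHat e A) a b ->
     (a = a0 \/ a = - a0) /\ (b = b0 \/ b = - b0)) ->
  exists2 m : R, 0 < m & forall a b, enorm a = 1 -> enorm b = 1 ->
    (forall s t : bool,
      rho < `|a - (-1) ^+ s *: a0| \/ rho < `|b - (-1) ^+ t *: b0|) ->
    m <= objective e A a b.
Proof.
move=> rho0 zeros.
pose dist (x : 'rV[R]_n1 * 'rV[R]_n2) (st : bool * bool) :=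
  `|x - ((-1) ^+ st.1 *: a0^T, (-1) ^+ st.2 *: b0^T)|.
pose F := \bigcap_(st in [set: bool * bool])
  (dist ^~ st @^-1` [set y | rho <= y]).
pose K := ([set x : 'rV[R]_n1 | enorm x^T = 1]
            `*` [set x : 'rV[R]_n2 | enorm x^T = 1]) `&` F.
have cK : compact K.
  apply: compact_closedI.
    exact: compact_setX (@compact_sphere _ _) (@compact_sphere _ _).
  apply: closed_bigI => st _; apply: preimage_closed; last exact: closed_ge.
  by move=> x _; apply: cvg_norm; apply: cvgB; [exact: cvg_id | exact: cvg_cst].
have [|m m0 mK] :=
    compact_pos_lower_bound cK (@objective_continuous _ _ _ _ _ e A).
  move=> [x y] [[/= x1 y1] far].
  rewrite lt_neqAle eq_sym; apply/andP; split; last first.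
    by do 3! (apply: sumr_ge0 => ? _); exact: sqr_ge0.
  apply/eqP => ob0; have [|xa yb] := zeros _ _ x1 y1.
    move=> _ [k [s [t [st ->]]]]; apply/eqP.
    rewrite eq_le sqr_ge0 andbT -ob0; exact: psi_le_objective.
  have [s xs] : exists s : bool, x = (-1) ^+ s *: a0^T.
    case: xa => xa; [exists false|exists true];
      rewrite ?expr0 ?expr1 -[x]trmxK xa.
      by rewrite scale1r.
    by rewrite scaleN1r linearN.
  have [t yt] : exists t : bool, y = (-1) ^+ t *: b0^T.
    case: yb => yb; [exists false|exists true];
      rewrite ?expr0 ?expr1 -[y]trmxK yb.
      by rewrite scale1r.
    by rewrite scaleN1r linearN.
  have /= := far (s, t) I.
  by rewrite /dist xs yt subrr normr0 leNgt rho0.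
exists m => // a b a1 b1 far.
have := mK (a^T, b^T); rewrite /= !trmxK; apply; split => [|[s t] _] /=.
  by rewrite !trmxK.
have norm_tr n (x y : 'cV[R]_n) : `|x - y| <= `|x^T - y^T|.
  apply: mx_norm_le => // i j.
  have -> : (x - y) i j = (x^T - y^T) j i by rewrite !mxE.
  exact: mx_coord_le.
rewrite /dist /= -!linearZ/=.
rewrite prod_normE le_max /=.
have [H|H] := far s t; apply/orP; [left|right];
  exact: le_trans (ltW H) (norm_tr _ _ _).
Qed.

Local Close Scope classical_set_scope.

(** Near the zero set [local_error_bound] applies after a change of signs;
    elsewhere the gap forces some residual to be large. *)
Lemma error_bound (R : realType) n1 n2 n3
    (Om : {set 'I_n1 * 'I_n2 * 'I_n3}) (e : enumeration Om)
    (a0 : 'cV[R]_n1) (b0 : 'cV[R]_n2) (c : 'cV[R]_n3) :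
  enorm a0 = 1 -> enorm b0 = 1 -> \rank (Zmx e a0 b0 c) = (n1 + n2)%N ->
  (forall a b, enorm a = 1 -> enorm b = 1 ->
     common_zero (PsiHat e (outer a0 b0 c)) a b ->
     (a = a0 \/ a = - a0) /\ (b = b0 \/ b = - b0)) ->
  exists K tau : R, [/\ 0 < K, 0 < tau &
    forall a b t, enorm a = 1 -> enorm b = 1 -> 0 <= t -> t < tau ->
    (forall k (s s' : 'I_(msize Om k)), (s < s')%N ->
      `|resid (outer a0 b0 c) k (e k s) (e k s') a b| <= t) ->
    exists s t' : bool,
      `|a - (-1) ^+ s *: a0| <= K * t /\ `|b - (-1) ^+ t' *: b0| <= K * t].
Proof.
move=> a1 b1 rZ zeros.
have [K [rho [K0 rho0 near]]] := local_error_bound a1 b1 rZ.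
have [m m0 gap] := objective_gap rho0 zeros.
(* As t < 1, the objective is at most npairs * t^2 <= npairs * t < m, so the
   point is not in the region where the gap holds. *)
exists K, (Num.min 1 (m / ((npairs Om)%:R + 1))); split=> //.
  by rewrite lt_min ltr01 divr_gt0// ltr_wpDl.
move=> a b t a1' b1' t0.
rewrite lt_min ltr_pdivlMr ?ltr_wpDl// => /andP[t1 tm] rt.
have flip n (x x0 : 'cV[R]_n) (r : bool) :
    `|(-1) ^+ r *: x - x0| = `|x - (-1) ^+ r *: x0|.
  have -> : (-1) ^+ r *: x - x0 = (-1) ^+ r *: (x - (-1) ^+ r *: x0).
    by rewrite scalerBr signrZK.
  by rewrite normrZ normr_sign mul1r.
have [/existsP[s /existsP[t' /andP[sa tb]]]|far] := boolP
    [exists s : bool, exists t' : bool,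
      (`|a - (-1) ^+ s *: a0| <= rho) && (`|b - (-1) ^+ t' *: b0| <= rho)].
  exists s, t'; rewrite -!flip in sa tb *; apply: near => //.
  - by rewrite addrC subrK enorm1_sign.
  - by rewrite addrC subrK enorm1_sign.
  move=> k q q' qq'; rewrite [a0 + _]addrC [b0 + _]addrC !subrK.
  by rewrite normr_resid_sign; exact: rt.
have ob := objective_le rt.
have sq : (npairs Om)%:R * t ^+ 2 <= (npairs Om)%:R * t.
  by rewrite ler_wpM2l// expr2 ler_piMr// ltW.
have mob : m <= objective e (outer a0 b0 c) a b.
  apply: gap => // s t'; apply/orP; rewrite !ltNge -negb_and.
  by apply: contra far => H; apply/existsP; exists s; apply/existsP; exists t'.
by exfalso; lra.
Qed.

(** * Residuals at a minimizer of the noisy objective *)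

Lemma tnorm_on_ge0 (R : realType) n1 n2 n3 Om (B : tensor R n1 n2 n3) :
  0 <= tnorm_on Om B.
Proof. exact: sqrtr_ge0. Qed.

Lemma entry_le_tnorm_on (R : realType) n1 n2 n3
    (Om : {set 'I_n1 * 'I_n2 * 'I_n3})
    (B : tensor R n1 n2 n3) x :
  x \in Om -> `|B x| <= tnorm_on Om B.
Proof.
move=> xOm; rewrite -[leLHS]ger0_norm// -sqrtr_sqr ler_wsqrtr//.
by rewrite (bigD1 x)//= lerDl sumr_ge0// => y _; exact: sqr_ge0.
Qed.

Lemma tnorm_le (R : realType) n1 n2 n3 (B : tensor R n1 n2 n3) (T : R) :
  0 <= T -> (forall x, `|B x| <= T) -> tnorm B <= (n1 * n2 * n3)%:R * T.
Proof.
move=> T0 BT; have N0 : 0 <= (n1 * n2 * n3)%:R * T by rewrite mulr_ge0.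
rewrite -[leRHS]ger0_norm// -sqrtr_sqr ler_wsqrtr// exprMn.
apply: (@le_trans _ _ (\sum_(i < n1) \sum_(j < n2) \sum_(k < n3) T ^+ 2)).
  do 3! (apply: ler_sum => ? _).
  by rewrite -[leLHS]real_normK ?num_real//; apply: lerXn2r; rewrite ?nnegrE.
rewrite !sumr_const !card_ord -!mulrnA -[leLHS]mulr_natl ler_wpM2r ?sqr_ge0//.
rewrite -natrX ler_nat [(n2 * n1)%N]mulnC [(n3 * _)%N]mulnC.
by case: (n1 * n2 * n3)%N => // l; rewrite leq_pmulr.
Qed.

Lemma enumeration_mem n1 n2 n3 (Om : {set 'I_n1 * 'I_n2 * 'I_n3})
    (e : enumeration Om) (e_enum : enumerates e) k (s : 'I_(msize Om k)) :
  (e k s, k) \in Om.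
Proof.
have [_ /(_ (e k s))] := e_enum k.
by rewrite codom_f inE => /esym.
Qed.

Lemma resid_perturb (R : realType) n1 n2 n3 (A B : tensor R n1 n2 n3)
    k p q (a : 'cV[R]_n1) (b : 'cV[R]_n2) (t : R) :
  enorm a = 1 -> enorm b = 1 ->
  `|A (p, k) - B (p, k)| <= t -> `|A (q, k) - B (q, k)| <= t ->
  `|resid A k p q a b - resid B k p q a b| <= 2 * t.
Proof.
move=> a1 b1 pt qt.
have -> : resid A k p q a b - resid B k p q a b =
    (A (p, k) - B (p, k)) * (a q.1 0 * b q.2 0)
    - (A (q, k) - B (q, k)) * (a p.1 0 * b p.2 0) by rewrite /resid; ring.
have ab1 i j : `|a i 0 * b j 0| <= 1.
  by rewrite normrM mulr_ile1// enorm1_coord_le.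
rewrite (le_trans (ler_normB _ _))// [2 * _]mulr_natl mulr2n lerD// normrM.
  by rewrite (le_trans _ pt)// ler_piMr.
by rewrite (le_trans _ qt)// ler_piMr.
Qed.

Lemma resid_outer_self (R : realType) n1 n2 n3 (a : 'cV[R]_n1) (b : 'cV[R]_n2)
    (c : 'cV[R]_n3) k p q :
  resid (outer a b c) k p q a b = 0.
Proof. by rewrite /resid !ffunE /=; ring. Qed.

(** Comparing the values of the perturbed objective at the minimizer and at the
    reference point, where it is quadratically small, bounds the unperturbed
    residuals at the minimizer linearly in the noise. *)
Lemma minimizer_resid_le (R : realType) n1 n2 n3
    (Om : {set 'I_n1 * 'I_n2 * 'I_n3}) (e : enumeration Om)
    (e_enum : enumerates e)
    (a0 : 'cV[R]_n1) (b0 : 'cV[R]_n2) (c : 'cV[R]_n3)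
    (A : tensor R n1 n2 n3) (t : R) a b :
  enorm a0 = 1 -> enorm b0 = 1 ->
  (forall x, x \in Om -> `|A x - outer a0 b0 c x| <= t) ->
  minimizer e A a b ->
  forall k (s s' : 'I_(msize Om k)), (s < s')%N ->
    `|resid (outer a0 b0 c) k (e k s) (e k s') a b|
      <= (2 * (npairs Om)%:R + 2) * t.
Proof.
move=> a01 b01 At [/feasible_unit[a1 b1] min] k s s' ss'.
have Ae l r := At _ (@enumeration_mem _ _ _ _ _ e_enum l r).
have t0 : 0 <= t := le_trans (normr_ge0 _) (Ae k s).
have f0 : objective e A a0 b0 <= (npairs Om)%:R * (2 * t) ^+ 2.
  apply: objective_le => l q q' _.
  rewrite -[resid _ _ _ _ _ _]subr0.
  rewrite -(resid_outer_self a0 b0 c l (e l q) (e l q')).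
  exact: resid_perturb.
have fab : objective e A a b <= objective e A a0 b0.
  by apply: min; apply/feasible_unit.
have rA : `|resid A k (e k s) (e k s') a b| <= 2 * (npairs Om)%:R * t.
  have N0 : 0 <= 2 * (npairs Om)%:R * t by rewrite !mulr_ge0.
  rewrite -(ler_pXn2r (n := 2)) ?nnegrE// real_normK ?num_real//.
  rewrite (le_trans (psi_le_objective e A a b ss'))// (le_trans fab)//.
  rewrite (le_trans f0)// !exprMn mulrCA mulrA ler_wpM2r ?sqr_ge0//.
  rewrite ler_wpM2l ?sqr_ge0// -natrX ler_nat.
  by case: (npairs Om) => // l; rewrite leq_pmulr.
have := resid_perturb a1 b1 (Ae k s) (Ae k s').
move: rA; rewrite !ler_norml => /andP[? ?] /andP[? ?].
by apply/andP; split; lra.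
Qed.

(** * Recovery of the tensor *)

(** Stability of a one-dimensional least squares solution: [c] solves the
    problem with data [c * q s] exactly, and the normal equation is perturbed
    by terms of size [h]. *)
Lemma least_squares_stability (R : realType) (I : finType) (p q A : I -> R)
    (c d h : R) :
  0 < d -> (forall s, `|p s| <= 1) ->
  (forall s, `|p s - q s| <= h) -> (forall s, `|A s - q s * c| <= h) ->
  d <= \sum_s p s ^+ 2 ->
  `|(\sum_s A s * p s) / (\sum_s p s ^+ 2) - c| <= #|I|%:R * (1 + `|c|) * h / d.
Proof.
move=> d0 p1 pq Aq dS; set S := \sum_s p s ^+ 2.
have S0 : 0 < S by exact: lt_le_trans dS.
have -> : (\sum_s A s * p s) / S - c = (\sum_s (A s - p s * c) * p s) / S.
  apply: (mulIf (lt0r_neq0 S0)); rewrite mulrBl !divfK ?gt_eqF//.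
  rewrite [c * S]mulr_sumr -sumrB.
  by apply: eq_bigr => s _; ring.
have hs s : `|A s - p s * c| <= (1 + `|c|) * h.
  have -> : A s - p s * c = (A s - q s * c) - (p s - q s) * c by ring.
  rewrite (le_trans (ler_normB _ _))// [leRHS]mulrDl mul1r lerD// normrM mulrC.
  by rewrite ler_wpM2l.
rewrite normrM normfV (ger0_norm (ltW S0)).
apply: ler_pM; rewrite ?invr_ge0 ?(ltW S0)//; last by rewrite lef_pV2.
rewrite (le_trans (ler_norm_sum _ _ _))// -mulrA mulr_natl -sumr_const.
apply: ler_sum => s _; rewrite normrM (le_trans _ (hs s))// ler_piMr//.
Qed.

(** For numbers of size at most 1, squaring is Lipschitz with constant 2. *)
Lemma sum_sqr_lower_bound (R : realType) (I : finType) (p q : I -> R) (h : R) :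
  (forall s, `|p s| <= 1) -> (forall s, `|q s| <= 1) ->
  (forall s, `|p s - q s| <= h) ->
  \sum_s q s ^+ 2 - 2 * #|I|%:R * h <= \sum_s p s ^+ 2.
Proof.
move=> p1 q1 pq.
rewrite lerBlDr addrC -lerBlDr -sumrB.
have -> : 2 * #|I|%:R * h = \sum_(s : I) 2 * h.
  by rewrite sumr_const -mulr_natl; ring.
apply: ler_sum => s _; rewrite subr_sqr (le_trans (ler_norm _))// normrM mulrC.
rewrite distrC ler_pM// (le_trans (ler_normD _ _))// -[2]/(1 + 1) lerD//.
Qed.

(** Nonsingularity makes the sum over each slice positive, and there are finitely
    many slices. *)
Lemma nonsingular_denominator (R : realType) n1 n2 n3
    (Om : {set 'I_n1 * 'I_n2 * 'I_n3}) (e : enumeration Om)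
    (a : 'cV[R]_n1) (b : 'cV[R]_n2) :
  nonsingular e a b ->
  exists2 d : R, 0 < d & forall k,
    d <= \sum_(s < msize Om k) (a (e k s).1 0 * b (e k s).2 0) ^+ 2.
Proof.
move=> ns.
pose D k := \sum_(s < msize Om k) (a (e k s).1 0 * b (e k s).2 0) ^+ 2.
exists (\big[Num.min/1]_k D k); last by move=> k; exact: bigmin_le.
apply/bigmin_gtP; split=> // k _.
rewrite lt_neqAle sumr_ge0 ?andbT; last by move=> ? _; exact: sqr_ge0.
apply/eqP => D0; apply: ns; exists k; right => s.
have /eqP := esym D0; rewrite psumr_eq0 => [/allP/(_ s (mem_index_enum _))|? _].
  by rewrite /= sqrf_eq0 => /eqP.
exact: sqr_ge0.
Qed.

Lemma nonsingular_of_denominator (R : realType) n1 n2 n3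
    (Om : {set 'I_n1 * 'I_n2 * 'I_n3}) (e : enumeration Om)
    (a : 'cV[R]_n1) (b : 'cV[R]_n2) :
  (forall k, 0 < \sum_(s < msize Om k) (a (e k s).1 0 * b (e k s).2 0) ^+ 2) ->
  nonsingular e a b.
Proof.
move=> pos [k sing]; have := pos k; rewrite big1 ?ltxx// => s _.
case: sing => [m0|->]; last by rewrite expr0n.
by have := leq_trans (leq_ltn_trans (leq0n s) (ltn_ord s)) (eq_leq m0).
Qed.

Lemma product_perturb (R : realType) n1 n2 (a a0 : 'cV[R]_n1) (b b0 : 'cV[R]_n2)
    i j (t : R) :
  enorm a = 1 -> enorm b0 = 1 -> `|a - a0| <= t -> `|b - b0| <= t ->
  `|a i 0 * b j 0 - a0 i 0 * b0 j 0| <= 2 * t.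
Proof.
move=> a1 b1 at0 bt0.
have -> : a i 0 * b j 0 - a0 i 0 * b0 j 0 =
   a i 0 * (b - b0) j 0 + (a - a0) i 0 * b0 j 0 by rewrite !mxE; ring.
rewrite (le_trans (ler_normD _ _))// [2 * _]mulr_natl mulr2n !normrM lerD//.
  rewrite (le_trans _ (le_trans (mx_coord_le (b - b0) j 0) bt0))// ler_piMl//.
  exact: enorm1_coord_le.
rewrite (le_trans _ (le_trans (mx_coord_le (a - a0) i 0) at0))// ler_piMr//.
exact: enorm1_coord_le.
Qed.

(** The recovered coefficients are close to those of the reference tensor up to
    the product of the two signs, which the factors [a] and [b] cancel. *)
Lemma recovery_bound (R : realType) n1 n2 n3
    (Om : {set 'I_n1 * 'I_n2 * 'I_n3}) (e : enumeration Om)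
    (e_enum : enumerates e)
    (a0 a : 'cV[R]_n1) (b0 b : 'cV[R]_n2) (c : 'cV[R]_n3)
    (A : tensor R n1 n2 n3) (s t : bool) (d h : R) :
  enorm a0 = 1 -> enorm b0 = 1 -> enorm a = 1 -> enorm b = 1 ->
  0 < d -> 0 <= h ->
  (forall k,
    d <= \sum_(r < msize Om k) (a0 (e k r).1 0 * b0 (e k r).2 0) ^+ 2) ->
  (forall i j, `|a i 0 * b j 0
     - ((-1) ^+ s *: a0) i 0 * ((-1) ^+ t *: b0) j 0| <= h) ->
  (forall x, x \in Om -> `|A x - outer a0 b0 c x| <= h) ->
  4 * (n1 * n2)%:R * h <= d ->
  nonsingular e a b /\
  tnorm (outer a b (cstar e A a b) - outer a0 b0 c)
    <= (n1 * n2 * n3)%:R * ((n1 * n2)%:R * (1 + `|c|) / (d / 2) + `|c|) * h.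
Proof.
move=> a01 b01 a1 b1 d0 h0 dD ph Ah hd.
(* The reference tensor is also the product of the signed values q and c'. *)
pose p (x : 'I_n1 * 'I_n2) := a x.1 0 * b x.2 0.
pose q (x : 'I_n1 * 'I_n2) := ((-1) ^+ s *: a0) x.1 0 * ((-1) ^+ t *: b0) x.2 0.
pose c' k := (-1) ^+ s * ((-1) ^+ t * c k 0).
have p1 x : `|p x| <= 1 by rewrite normrM mulr_ile1// enorm1_coord_le.
have q1 x : `|q x| <= 1.
  by rewrite normrM mulr_ile1// enorm1_coord_le// enorm1_sign.
have qE x : q x = (-1) ^+ s * ((-1) ^+ t * (a0 x.1 0 * b0 x.2 0)).
  by rewrite /q !mxE; ring.
have qc x k : q x * c' k = outer a0 b0 c (x, k).
  rewrite qE /c' ffunE /=.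
  transitivity (((-1) ^+ s) ^+ 2 * ((-1) ^+ t) ^+ 2
                * (a0 x.1 0 * b0 x.2 0 * c k 0)).
    by ring.
  by rewrite !sqrr_sign !mul1r.
have c'c k : `|c' k| <= `|c| by rewrite /c' !normrMsign mx_coord_le.
have card k : (msize Om k)%:R <= (n1 * n2)%:R :> R.
  rewrite ler_nat (leq_trans (max_card _))//.
  by rewrite card_prod !card_ord.
have dp k : d / 2 <= \sum_(r < msize Om k) p (e k r) ^+ 2.
  have D : d <= \sum_(r < msize Om k) q (e k r) ^+ 2.
    rewrite (le_trans (dD k))//; apply: ler_sum => r _.
    by rewrite qE !exprMn !sqrr_sign !mul1r.
  have := @sum_sqr_lower_bound _ _ (p \o e k) (q \o e k) h
    (fun r => p1 _) (fun r => q1 _) (fun r => ph _ _).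
  have := ler_wpM2r h0 (card k).
  by rewrite card_ord /=; lra.
have d20 : 0 < d / 2 by rewrite divr_gt0.
split.
  by apply: nonsingular_of_denominator => k; exact: lt_le_trans (dp k).
set E := (n1 * n2)%:R * (1 + `|c|) / (d / 2).
have E0 : 0 <= E by apply: divr_ge0 (ltW d20); rewrite mulr_ge0 ?addr_ge0.
have cs k : `|cstar e A a b k 0 - c' k| <= E * h.
  have := @least_squares_stability _ _ (p \o e k) (q \o e k)
    (fun r => A (e k r, k)) (c' k) _ h d20 (fun r => p1 _)
    (fun r => ph _ _) _ (dp k).
  rewrite /= card_ord mxE.
  have -> : \sum_(r < msize Om k) A (e k r, k) * a (e k r).1 0 * b (e k r).2 0
          = \sum_(r < msize Om k) A (e k r, k) * p (e k r).
    by apply: eq_bigr => r _; rewrite mulrA.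
  move=> H; apply: le_trans (H _) _.
    by move=> r; rewrite qc Ah// enumeration_mem.
  rewrite /E [leRHS]mulrAC ler_wpM2r ?invr_ge0 ?(ltW d20)// ler_wpM2r//.
  by apply: ler_pM; rewrite ?addr_ge0 ?card// lerD2l.
rewrite -mulrA; apply: tnorm_le => [|[[i j] k]].
  by rewrite mulr_ge0// addr_ge0.
have -> : (outer a b (cstar e A a b) - outer a0 b0 c) (i, j, k)
        = p (i, j) * (cstar e A a b k 0 - c' k) + (p (i, j) - q (i, j)) * c' k.
  by have := qc (i, j) k; rewrite !ffunE /= => <-; rewrite /p /=; ring.
rewrite (le_trans (ler_normD _ _))// [leRHS]mulrDl lerD// normrM.
  by rewrite (le_trans _ (cs k))// ler_piMl.
by rewrite mulrC ler_pM// (ph i j).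
Qed.

Theorem theorem3p5 (R : realType) (n1 n2 n3 : nat)
    (n1_gt0 : (0 < n1)%N) (n2_gt0 : (0 < n2)%N) (n3_gt0 : (0 < n3)%N)
    (Om : {set 'I_n1 * 'I_n2 * 'I_n3})
    (e : enumeration Om) (e_enum : enumerates e)
    (ah : 'cV[R]_n1) (bh : 'cV[R]_n2) (ch : 'cV[R]_n3)
    (ah_neq0 : ah != 0) (bh_neq0 : bh != 0) (ch_neq0 : ch != 0)
    (ah_unit : enorm ah = 1) (bh_unit : enorm bh = 1)
    (rankZ : \rank (Zmx e ah bh ch) = (n1 + n2)%N)
    (zeros_Psi : forall (a : 'cV[R]_n1) (b : 'cV[R]_n2),
      enorm a = 1 -> enorm b = 1 ->
      (common_zero (PsiHat e (outer ah bh ch)) a b <->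
       (a = ah \/ a = - ah) /\ (b = bh \/ b = - bh)))
    (ah_bh_nonsingular : nonsingular e ah bh)
    (ch_coord_neq0 : forall k : 'I_n3, ch k 0 != 0) :
  exists C eps : R, 0 < C /\ 0 < eps /\
    forall A dA : tensor R n1 n2 n3,
      (forall x, x \in Om -> A x = outer ah bh ch x + dA x) ->
      tnorm_on Om dA < eps ->
      forall (a : 'cV[R]_n1) (b : 'cV[R]_n2),
        minimizer e A a b ->
        nonsingular e a b /\
        tnorm (outer a b (cstar e A a b) - outer ah bh ch)
          <= C * tnorm_on Om dA.
Proof.
have [K [tau [K0 tau0 err]]] := error_bound ah_unit bh_unit rankZ
  (fun a b a1 b1 => (zeros_Psi a b a1 b1).1).
have [d d0 dD] := nonsingular_denominator ah_bh_nonsingular.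
set N := 2 * (npairs Om)%:R + 2 : R.
have N0 : 0 < N by rewrite ltr_wpDl// mulr_ge0.
(* Both the products of coordinates (by 2 K N t) and the observed entries (by t)
   stay within L t of their reference values. *)
set L := 2 * (K * N) + 1.
have L0 : 0 < L by rewrite ltr_wpDl// !mulr_ge0// ltW.
(* The noise level d / M is what the denominators tolerate. *)
set M := 4 * (n1 * n2)%:R * L + 1.
have M0 : 0 < M by rewrite ltr_wpDl// !mulr_ge0// ltW.
set B := (n1 * n2 * n3)%:R * ((n1 * n2)%:R * (1 + `|ch|) / (d / 2) + `|ch|).
have B0 : 0 <= B by rewrite !(mulr_ge0, addr_ge0) ?invr_ge0 ?divr_ge0// ltW.
exists (B * L + 1), (Num.min (tau / N) (d / M)).
split; first by rewrite ltr_wpDl// mulr_ge0// ltW.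
split; first by rewrite lt_min !divr_gt0.
move=> A dA AdA; set t := tnorm_on Om dA.
have t0 : 0 <= t := tnorm_on_ge0 _ _.
rewrite lt_min !ltr_pdivlMr// => /andP[tN tM] a b min.
have At x : x \in Om -> `|A x - outer ah bh ch x| <= t.
  by move=> xOm; rewrite AdA// addrC addKr entry_le_tnorm_on.
have /feasible_unit[a1 b1] := min.1.
have tL : t <= L * t.
  by rewrite ler_peMl// lerDr !mulr_ge0// ltW.
have Nt0 : 0 <= N * t by rewrite mulr_ge0// ltW.
have [||s [s' [sa sb]]] := err a b (N * t) a1 b1 Nt0.
- by rewrite mulrC.
- exact (minimizer_resid_le e_enum ah_unit bh_unit At min).
have [||||ns bound] :=
    @recovery_bound _ _ _ _ _ _ e_enum ah a bh b ch A s s' d (L * t)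
    ah_unit bh_unit a1 b1 d0 _ dD.
- by rewrite mulr_ge0// ltW.
- move=> i j; rewrite (le_trans (product_perturb _ _ a1 _ sa sb))//.
    exact: enorm1_sign.
  have -> : L * t = 2 * (K * (N * t)) + t by rewrite /L; ring.
  by rewrite lerDl.
- by move=> x xOm; rewrite (le_trans (At x xOm)).
- by move: tM; rewrite /M mulrDr mulr1 => tM; rewrite mulrA (mulrC _ t); lra.
split=> //; rewrite (le_trans bound)// -/B [leLHS]mulrA [leRHS]mulrDl mul1r.
by rewrite lerDl.
Qed.
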